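(* Let $I\subseteq\mathbb{R}$ be an open interval and let $p,q:I\to\mathbb{R}$ be arbitrary functions. Let $f:I\to\mathbb{R}$ be a differentiable function satisfying $f'(x)=p(x)f(x)$ on $I$, let $y:I\to\mathbb{R}$ be a twice differentiable function satisfying $y''(x)+p(x)y'(x)+q(x)y(x)=0$ on $I$, and let $h:I\to\mathbb{R}$ be an arbitrary twice differentiable function. Then $$\int f(x)\left(h''(x)+h'(x)p(x)+h(x)q(x)\right)y(x)\,dx=f(x)\left(h'(x)y(x)-h(x)y'(x)\right),$$ i.e. the function $x\mapsto f(x)\left(h'(x)y(x)-h(x)y'(x)\right)$ is an antiderivative on $I$ of $x\mapsto f(x)\left(h''(x)+h'(x)p(x)+h(x)q(x)\right)y(x)$.
   Context: An indefinite integral identity $\int F(x)\,dx=G(x)$ means that $G$ is differentiable on the interval under consideration with $G'(x)=F(x)$ there (constants of integration are suppressed). *)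

(* Defs.v *)
From Stdlib Require Import Reals.
From Coquelicot Require Import Coquelicot.
Local Open Scope R_scope.

(* Endpoints range over [Rbar], so half-lines and the whole line are included. *)
Definition Rbar_open_interval (a b : Rbar) (x : R) : Prop :=
  Rbar_lt a x /\ Rbar_lt x b.

(* A function on an open interval [D] is represented by a total function
   [R -> R] whose values outside [D] are irrelevant: since [D] is open,
   differentiability and derivatives at points of [D] only depend on the
   restriction to [D]. *)
Definition differentiable_on (D : R -> Prop) (u : R -> R) : Prop :=
  forall x : R, D x -> ex_derive u x.

(* [Derive] is total (with a junk value where [u] is not differentiable), so
   differentiability of [u] itself has to be required as well. *)
Definition twice_differentiable_on (D : R -> Prop) (u : R -> R) : Prop :=
  differentiable_on D u /\ differentiable_on D (Derive u).

(* [G] is an indefinite integral of [F] on [D]; constants are suppressed. *)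
Definition antiderivative_on (D : R -> Prop) (F G : R -> R) : Prop :=
  forall x : R, D x -> is_derive G x (F x).

(* Main.v *)
Require Import Defs.
From Stdlib Require Import Reals Lra.
From Coquelicot Require Import Coquelicot.
Local Open Scope R_scope.

(** This is Lagrange's identity with integrating factor [f]: since [f' = p f], the equation for [y]
    becomes [(f y')' = - f q y]. Hence [(f h' y - h f y')' = (f h')' y - h (f y')'], where
    [(f h')' = f (h'' + p h')], which is the integrand. *)

Theorem theorem1 (a b : Rbar) (p q f y h : R -> R)
  (f_diff : differentiable_on (Rbar_open_interval a b) f)
  (f_eq : forall x : R, Rbar_open_interval a b x -> Derive f x = p x * f x)
  (y_diff : twice_differentiable_on (Rbar_open_interval a b) y)
  (y_eq : forall x : R, Rbar_open_interval a b x ->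
     Derive_n y 2 x + p x * Derive y x + q x * y x = 0)
  (h_diff : twice_differentiable_on (Rbar_open_interval a b) h) :
  antiderivative_on (Rbar_open_interval a b)
    (fun x => f x * (Derive_n h 2 x + Derive h x * p x + h x * q x) * y x)
    (fun x => f x * (Derive h x * y x - h x * Derive y x)).
Proof.
  destruct y_diff as [dy ddy]; destruct h_diff as [dh ddh].
  intros x Dx.
  pose proof (Derive_correct _ _ (f_diff x Dx)) as Df.
  pose proof (Derive_correct _ _ (dy x Dx)) as Dy.
  pose proof (Derive_correct _ _ (ddy x Dx)) as DDy.
  pose proof (Derive_correct _ _ (dh x Dx)) as Dh.
  pose proof (Derive_correct _ _ (ddh x Dx)) as DDh.
  rewrite (f_eq x Dx) in Df.
  specialize (y_eq x Dx).
  change (Derive_n y 2 x) with (Derive (Derive y) x) in y_eq.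
  change (Derive_n h 2 x) with (Derive (Derive h) x).
  (* Eliminating [y''] through the equation brings in [q] and leaves only a polynomial identity in
     the values at [x]. *)
  replace (Derive (Derive y) x) with (- (p x * Derive y x + q x * y x)) in DDy by lra.
  (* The two [h' y'] terms of the Wronskian's derivative cancel, and [p h y']
     from [f' = p f] cancels the one from [y'']. *)
  evar_last.
  - apply (is_derive_mult f (fun t => Derive h t * y t - h t * Derive y t));
      [exact Df | | exact Rmult_comm].
    apply (is_derive_minus (fun t => Derive h t * y t) (fun t => h t * Derive y t)).
    + exact (is_derive_mult _ _ _ _ _ DDh Dy Rmult_comm).
    + exact (is_derive_mult _ _ _ _ _ Dh DDy Rmult_comm).
  (* The derivative rules yield abstract ring operations; [ring] needs those of [R]. *)
  - unfold minus, plus, opp, mult; simpl; ring.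
Qed.
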